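(* There is a constant $c>0$ such that for all integers $\ell,k,d\ge0$ with $4\le\ell\le\frac{d-2}{2}$ and $\ell+2k+2\le d$, the following holds. Let $X$ be a $d$-dimensional $\frac{1}{\ell(k+\ell)^2}$-two-sided link expander. Let $\Sigma$ be a finite alphabet and let $\{f_z:\mathrm{Ball}_z\to\Sigma\}_{z\in X(k)}$ be an ensemble, where $\mathrm{Ball}_z=\{v\in X(0)\setminus z: z\cup\{v\}\in X\}$. Let $\varepsilon$ be the rejection probability of either the weak independent agreement test or the weak complement agreement test. Then there is $G:X(0)\to\Sigma$ with $$\Pr_{z\in X(k)}\Big[\Pr_{v}[f_z(v)\neq G(v)]>\tfrac1\ell\Big]\le c\,\varepsilon,$$ where $v$ is distributed according to the vertex measure of the link $X_z$.
   Context: **Weighted simplicial complexes.** $X(j)$ denotes the faces of size $j+1$ of a $d$-dimensional simplicial complex $X$, weighted by a distribution on $X(d)$ (choose a $d$-face, then a uniform chain of subfaces). The link of $t$ is $X_t=\{u\setminus t:t\subseteq u\in X\}$, with $\Pr_{X_t}[u]=\Pr[u\cup t\mid t]$. **Expansion.** $X$ is a $\lambda$-two-sided link expander if for every face $s$ of size at most $d-1$ (including $\emptyset$), the random-walk operator of the underlying graph of $X_s$ (vertices $X_s(0)$, edges $X_s(1)$, weighted by the link measure) has all non-top eigenvalues in $[-\lambda,\lambda]$. **Complement walk.** The $(k,k)$-complement walk in a complex $Y$ chooses $u\in Y(2k+1)$ according to the measure and a uniformly random partition $u=z_1\sqcup z_2$ with $|z_1|=|z_2|=k+1$, and outputs $(z_1,z_2)$.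 **Weak agreement tests.** - Weak independent test: sample $t\in X(\ell)$, then $z_1,z_2\in X_t(k)$ independently according to the link measure, and accept iff $f_{z_1}|_t=f_{z_2}|_t$. Note that $t\subseteq\mathrm{Ball}_{z_i}$. - Weak complement test: sample $t\in X(\ell)$, then $(z_1,z_2)$ by the $(k,k)$-complement walk in $X_t$, and accept iff $f_{z_1}|_t=f_{z_2}|_t$. *)

(* Defs.v *)
From HB Require Import structures.
From mathcomp Require Import all_boot all_order all_algebra.
Set Implicit Arguments. Unset Strict Implicit. Unset Printing Implicit Defensive.
Import Order.TTheory GRing.Theory Num.Theory.
Local Open Scope ring_scope.

Section Complex.
Variables (R : rcfType) (V : finType).

(* A d-dimensional weighted complex is given by a probability distribution w
   on the d-faces (sets of size d+1). The complex X is the downward closure of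
   the support of w. *)
Definition is_weight (d : nat) (w : {set V} -> R) : Prop :=
  [/\ forall s, 0 <= w s,
      forall s, w s != 0 -> #|s| = d.+1
    & \sum_(s : {set V}) w s = 1].

(* Pr[u] for u in X(#|u|-1): choose a d-face s by w, then a uniform chain of
   subfaces; the level-#|u| face is a uniform (#|u|)-subset of s. *)
Definition face_pr (d : nat) (w : {set V} -> R) (u : {set V}) : R :=
  (\sum_(s : {set V} | u \subset s) w s) / ('C(d.+1, #|u|))%:R.

(* Faces of X: sets of positive measure (= subsets of a d-face in the support). *)
Definition is_face d w (u : {set V}) : bool := 0 < face_pr d w u.

(* Link measure: Pr_{X_t}[u] = Pr[u \cup t | t] in the chain process,
   i.e. Pr[level |u∪t| is u∪t and level |t| is t] / Pr[level |t| is t]. *)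
Definition link_pr d w (t u : {set V}) : R :=
  if [disjoint u & t] then
    face_pr d w (u :|: t) / (('C(#|u :|: t|, #|t|))%:R * face_pr d w t)
  else 0.

Definition link_verts d w (s : {set V}) : {set V} :=
  [set v | 0 < link_pr d w s [set v]].

Definition link_edge d w (s : {set V}) (a b : V) : R :=
  if a != b then link_pr d w s [set a; b] else 0.

Definition link_walk d w (s : {set V}) : 'M[R]_#|link_verts d w s| :=
  \matrix_(i, j)
    (link_edge d w s (enum_val i) (enum_val j) /
       \sum_(b : V) link_edge d w s (enum_val i) b).

(* All non-top eigenvalues (i.e. all eigenvalues, with multiplicity, after
   removing one copy of the top eigenvalue 1) lie in [-lam, lam]. *)
Definition nontop_eigs_in n (M : 'M[R]_n) (lam : R) : Prop :=
  exists q : {poly R},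
    char_poly M = ('X - 1%:P) * q /\
    forall x : R, root q x -> -lam <= x <= lam.

Definition two_sided_link_expander d w (lam : R) : Prop :=
  forall s : {set V}, (#|s| <= d.-1)%N -> is_face d w s ->
    nontop_eigs_in (link_walk d w s) lam.

Variable S : finType.

Definition agree_on (f : {set V} -> V -> S) (z1 z2 t : {set V}) : bool :=
  [forall v in t, f z1 v == f z2 v].

Definition weak_indep_rej d w (l k : nat) (f : {set V} -> V -> S) : R :=
  \sum_(t : {set V} | #|t| == l.+1) face_pr d w t *
    \sum_(z1 : {set V} | #|z1| == k.+1) \sum_(z2 : {set V} | #|z2| == k.+1)
      link_pr d w t z1 * link_pr d w t z2 * (~~ agree_on f z1 z2 t)%:R.

Definition compl_walk_pr d w (t : {set V}) (k : nat) (z1 z2 : {set V}) : R :=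
  if [&& [disjoint z1 & z2], #|z1| == k.+1 & #|z2| == k.+1] then
    link_pr d w t (z1 :|: z2) / ('C((k.+1).*2, k.+1))%:R
  else 0.

Definition weak_compl_rej d w (l k : nat) (f : {set V} -> V -> S) : R :=
  \sum_(t : {set V} | #|t| == l.+1) face_pr d w t *
    \sum_(z1 : {set V}) \sum_(z2 : {set V})
      compl_walk_pr d w t k z1 z2 * (~~ agree_on f z1 z2 t)%:R.

Definition far_fraction d w (l k : nat) (f : {set V} -> V -> S) (G : V -> S) : R :=
  \sum_(z : {set V} | #|z| == k.+1) face_pr d w z *
    (((l%:R)^-1 : R) < \sum_(v : V) link_pr d w z [set v] * (f z v != G v)%:R)%R%:R.

End Complex.

(* Main.v *)
Require Import Defs.
From HB Require Import structures.
From mathcomp Require Import all_boot all_order all_algebra.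
From mathcomp Require Import complex ring lra.
Import Order.TTheory GRing.Theory Num.Theory.
Local Open Scope ring_scope.
Set Implicit Arguments. Unset Strict Implicit. Unset Printing Implicit Defensive.

(** Let G v be the plurality value of f_z(v) over z in X_v(k), and let eps be the
    rejection probability of the independent test (the complement test rejects at
    least 3/4 as often, since the (k,k)-complement walk in X_t is (k+1)^2 lambda-expanding).

    Fix v. Passing from the distribution of f_z(v) over z in X_v(k) to the one over
    z in X_t(k), for a random t containing v, is a walk in X_v whose norm is at most
    Lambda = (k+1) l lambda <= 1/l. The mean squared drift of this distribution is
    therefore at most Lambda^2 times the probability that f_z1(v) and f_z2(v) differ,
    and the average of the latter over v is O(eps). The factor Lambda^2 <= 1/l^2
    pays for a union bound over the l+1 vertices of t. If no vertex of t drifts and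
    the local test at t rejects with probability eps_t < 1/4, then the most frequent
    value of f_z|t must be G|t, so that f_z|t differs from G|t with probability at
    most eps_t. Hence f_z|t differs from G|t with probability O(eps) over (t, z).

    Finally, if f_z and G differ on more than 1/l of the vertices of X_z, the second
    moment method shows that a random t in X_z(l) sees a difference with probability
    at least 1/3.

    The walks are controlled by bounding covariances of g(a) and h(b) over random
    disjoint faces a, b of a link: conditioning on one vertex of a at a time, the law
    of total covariance reduces this to the edges of links, i.e. to the hypothesis. *)

(** * Spectral bound for reversible walks *)

Lemma char_poly_similar (F : fieldType) n (P A B : 'M[F]_n) :
  P \in unitmx -> P *m A = B *m P -> char_poly A = char_poly B.
Proof.
move=> uP PA.
have uPC : \det (map_mx (@polyC F) P) != 0.
  by rewrite det_map_mx polyC_eq0 -unitfE -unitmxE.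
apply: (mulfI uPC); rewrite /char_poly -det_mulmx mulrC -det_mulmx.
congr (\det _); rewrite /char_poly_mx mulmxBl mulmxBr -!map_mxM PA.
by congr (_ - _); rewrite -scalar_mxC.
Qed.

Section Spectral.
Variable R : rcfType.
Local Notation toC := (real_complex R).
Local Open Scope sesquilinear_scope.

(** Over [R[i]] a real symmetric matrix is Hermitian, hence unitarily diagonalizable with real
    eigenvalues. Only [P] stays complex; the factorization of the characteristic polynomial descends
    to [R] because [toC] is injective on polynomials. *)
Lemma symmetric_diagonalization n (A : 'M[R]_n) : A^T = A ->
  exists (P : 'M[R[i]]_n) (D : 'I_n -> R),
    [/\ P *m P^t* = 1%:M, P^t* *m P = 1%:M,
        map_mx toC A = P^t* *m diag_mx (\row_i (toC (D i))) *m P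
      & char_poly A = \prod_i ('X - (D i)%:P)].
Proof.
move=> Asym; set A' := map_mx toC A.
have hA : A' \is hermsymmx.
  apply: realsym_hermsym.
    by apply/is_hermitianmxP; rewrite expr0 scale1r map_mx_id // /A' map_trmx Asym.
  by apply/mxOverP => i j; rewrite mxE; apply/complex_realP; exists (A i j).
have U := spectral_unitarymx A'.
have := hermitian_normalmx hA => /orthomx_spectralP; rewrite invmx_unitary //.
have DR := hermitian_spectral_diag_real hA.
set P := spectralmx A' in U *; set sp := spectral_diag A' in DR *.
move=> AE.
have spE : sp = \row_i toC (complex.Re (sp 0 i)).
  apply/rowP => i; rewrite !mxE RRe_real //; exact: (mxOverP DR).
exists P, (fun i => complex.Re (sp 0 i)); split.
- exact/unitarymxP.
- by rewrite -invmx_unitary // mulVmx // unitarymx_unit.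
- by rewrite -spE.
apply: (map_poly_inj toC); rewrite map_char_poly -/A'.
rewrite (@char_poly_similar _ _ P A' (diag_mx sp)) ?unitarymx_unit //; last first.
  by rewrite AE !mulmxA (unitarymxP _) // mul1mx.
rewrite char_poly_trig; last exact: diag_mx_is_trig.
rewrite rmorph_prod; apply: eq_bigr => i _ /=.
by rewrite map_polyXsubC {1}spE !mxE eqxx.
Qed.

(** In an orthonormal eigenbasis the form is a sum of eigenvalues times squared coordinates of [x].
    As [lam < 1], the eigenvalue 1 is simple with eigenvector [u], so the squared inner product with
    [u] removes exactly its term and the other eigenvalues are bounded by [lam]. *)
Lemma nontop_quadratic_bound n (A : 'M[R]_n) (u x : 'rV[R]_n) (lam : R) :
  A^T = A -> u *m A = u -> u *m u^T = 1%:M -> nontop_eigs_in A lam -> 0 <= lam < 1 ->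
  `|(x *m A *m x^T) 0 0 - ((x *m u^T) 0 0) ^+ 2| <= lam * (x *m x^T) 0 0.
Proof.
move=> Asym uA uu [q [chA rq]] /andP[lam0 lam1].
have [P [D [PP' P'P AE chD]]] := symmetric_diagonalization Asym.
pose y := map_mx toC x *m P^t*; pose c := map_mx toC u *m P^t*.
have cD i : c 0 i * toC (D i) = c 0 i.
  have : c *m diag_mx (\row_i toC (D i)) = c.
    rewrite /c -[in RHS]uA map_mxM AE -!mulmxA; congr (_ *m (_ *m _)).
    by rewrite PP' mulmx1.
  by move=> /rowP/(_ i); rewrite mul_mx_diag !mxE.
have realt m (z : 'rV[R]_m) : (map_mx toC z)^t* = map_mx toC z^T.
  by apply/matrixP => i j; rewrite !mxE; apply/CrealP/complex_realP; exists (z j i).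
have inner (z1 z2 : 'rV[R]_n) :
    map_mx toC (z1 *m z2^T) =
    (map_mx toC z1 *m P^t*) *m (map_mx toC z2 *m P^t*)^t*.
  rewrite trmx_mul [in RHS]map_mxM trmxCK realt mulmxA -[_ *m P^t* *m P]mulmxA P'P mulmx1.
  by rewrite map_mxM.
pose r i := complex.Re (y 0 i) ^+ 2 + complex.Im (y 0 i) ^+ 2.
have r0 i : 0 <= r i by rewrite addr_ge0 ?sqr_ge0.
have rE i : toC (r i) = y 0 i * (y 0 i)^* by rewrite add_Re2_Im2 normCK.
have xx : (x *m x^T) 0 0 = \sum_i r i.
  apply: complexI; rewrite rmorph_sum /=.
  have /matrixP/(_ 0 0) := inner x x; rewrite mxE => ->; rewrite mxE.
  by apply: eq_bigr => i _; rewrite rE !mxE.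
have xAx : (x *m A *m x^T) 0 0 = \sum_i D i * r i.
  apply: complexI; rewrite rmorph_sum /=.
  have -> : toC ((x *m A *m x^T) 0 0) = (y *m diag_mx (\row_i toC (D i)) *m y^t*) 0 0.
    have -> : toC ((x *m A *m x^T) 0 0) = (map_mx toC (x *m A *m x^T)) 0 0.
      by rewrite [RHS]mxE.
    congr (fun_of_matrix _ 0 0); rewrite /y [in RHS]trmx_mul [in RHS]map_mxM trmxCK realt !map_mxM AE.
    by rewrite !mulmxA.
  rewrite mul_mx_diag mxE; apply: eq_bigr => i _.
  rewrite rmorphM /= rE; rewrite !mxE; move: (toC _) (y 0 i) => a b; ring.
have root1 : root (char_poly A) 1 by rewrite chA rootM root_XsubC eqxx.
have [i0 Di0] : exists i, D i = 1.
  move: root1; rewrite chD /root horner_prod prodf_seq_eq0 => /hasP[i _].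
  by rewrite !hornerE /= subr_eq0 => /eqP Di; exists i.
(* Only one factor of the eigenvalue 1 is cancelled, so a second copy would be a root of [q] and
   violate [lam < 1]. *)
have qE : q = \prod_(i | i != i0) ('X - (D i)%:P).
  have /mulfI : ('X - 1%:P : {poly R}) != 0 by rewrite polyXsubC_eq0.
  by apply; rewrite -chA chD (bigD1 i0) //= Di0.
have Dlam i : i != i0 -> -lam <= D i <= lam.
  move=> ii0; apply: rq; rewrite qE /root horner_prod; apply/eqP.
  by rewrite (bigD1 i) //= !hornerE subrr mul0r.
have c0 i : i != i0 -> c 0 i = 0.
  move=> ii0; have /andP[_ Di] := Dlam i ii0.
  have : c 0 i * toC (D i - 1) = 0 by rewrite rmorphB rmorph1 mulrBr mulr1 cD subrr.
  move=> /eqP; rewrite mulf_eq0 => /orP[/eqP//|/eqP h].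
  have /complexI/eqP : toC (D i - 1) = toC 0 by rewrite h.
  by rewrite subr_eq0 => /eqP D1; rewrite D1 leNgt lam1 in Di.
have dotc (z : 'rV[R]_n) : toC ((z *m u^T) 0 0) = (map_mx toC z *m P^t*) 0 i0 * (c 0 i0)^*.
  have /matrixP/(_ 0 0) := inner z u; rewrite mxE => ->; rewrite mxE (bigD1 i0) //=.
  rewrite big1 ?addr0 => [|i ii0]; first by rewrite -/c [_^t* _ _]mxE [c^T _ _]mxE.
  by rewrite -/c [c^t* _ _]mxE [c^T _ _]mxE c0 // conjC0 mulr0.
have cc : c 0 i0 * (c 0 i0)^* = 1 by rewrite -dotc uu mxE.
have xu : (x *m u^T) 0 0 ^+ 2 = r i0.
  apply: complexI; rewrite rE.
  have h := dotc x; rewrite -/y in h.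
  have h' : toC ((x *m u^T) 0 0) = (y 0 i0)^* * c 0 i0.
    have : (toC ((x *m u^T) 0 0))^* = toC ((x *m u^T) 0 0).
      by apply/CrealP/complex_realP; eexists.
    by rewrite h rmorphM /= conjCK => <-.
  rewrite expr2 rmorphM /= {1}h h' -[RHS]mulr1 -cc; ring.
rewrite xAx xu xx (bigD1 i0) //= Di0 mul1r addrC addrK.
rewrite (le_trans (ler_norm_sum _ _ _)) // mulr_sumr [leRHS](bigD1 i0) //=.
rewrite -[leLHS]add0r lerD ?mulr_ge0 // ler_sum // => i ii0.
by rewrite normrM (ger0_norm (r0 i)) ler_wpM2r // ler_norml Dlam.
Qed.
End Spectral.

(** Conjugation by the square roots of the stationary distribution [p] turns the reversible [W] into
    a symmetric matrix with the same characteristic polynomial, whose top eigenvector is the vector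
    of these roots. The quadratic bound then extends to two functions by polarization. *)
Lemma reversible_cov_bound (R : rcfType) n (W : 'M[R]_n) (p : 'I_n -> R) lam :
  (forall i, 0 < p i) -> \sum_i p i = 1 ->
  (forall i j, p i * W i j = p j * W j i) -> (forall i, \sum_j W i j = 1) ->
  nontop_eigs_in W lam -> 0 <= lam < 1 -> forall g h : 'I_n -> R,
  \sum_i p i * (g i * \sum_j W i j * h j) - (\sum_i p i * g i) * (\sum_i p i * h i) <=
  lam / 2 * (\sum_i p i * g i ^+ 2 + \sum_i p i * h i ^+ 2).
Proof.
move=> p0 p1 rev W1 eigs lam01 g h.
pose s i := Num.sqrt (p i).
have s0 i : s i != 0 by rewrite gt_eqF // sqrtr_gt0.
have ss i : s i * s i = p i by rewrite -expr2 sqr_sqrtr // ltW.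
pose A := \matrix_(i, j) (s i * W i j / s j).
pose D := diag_mx (\row_i s i).
have uD : D \in unitmx.
  by rewrite unitmxE det_diag unitfE; apply/prodf_neq0 => i _; rewrite mxE.
have DW : D *m W = A *m D.
  by apply/matrixP => i j; rewrite mul_diag_mx mul_mx_diag !mxE divfK.
have Asym : A^T = A.
  apply/matrixP => i j; rewrite !mxE.
  apply: (mulIf (s0 i)); apply: (mulIf (s0 j)); rewrite divfK //.
  by rewrite [RHS]mulrAC divfK // [LHS]mulrAC [RHS]mulrAC !ss rev.
have eigsA : nontop_eigs_in A lam.
  by case: eigs => q [qE qr]; exists q; split=> //; rewrite -(char_poly_similar uD DW).
pose u := \row_i s i.
have uA : u *m A = u.
  apply/rowP => j; rewrite !mxE -[RHS](mulfK (s0 j)) ss -[in RHS](mulr1 (p j)) -(W1 j).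
  rewrite mulr_sumr mulr_suml; apply: eq_bigr => i _; rewrite !mxE.
  by rewrite -rev -ss !mulrA.
have uu : u *m u^T = 1%:M.
  apply/matrixP => i j; rewrite !ord1 !mxE eqxx mulr1n -p1.
  by apply: eq_bigr => k _; rewrite !mxE ss.
pose B (f1 f2 : 'I_n -> R) :=
  \sum_i \sum_j (p i * W i j - p i * p j) * (f1 i * f2 j).
have BE f1 f2 : B f1 f2 = \sum_i p i * (f1 i * \sum_j W i j * f2 j) -
    (\sum_i p i * f1 i) * (\sum_i p i * f2 i).
  rewrite mulr_suml -sumrB; apply: eq_bigr => i _.
  rewrite mulr_sumr !mulr_sumr -sumrB; apply: eq_bigr => j _; ring.
have Bsym f1 f2 : B f1 f2 = B f2 f1.
  rewrite /B exchange_big; apply: eq_bigr => i _; apply: eq_bigr => j _.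
  rewrite rev; ring.
have Bquad f : `|B f f| <= lam * \sum_i p i * f i ^+ 2.
  pose x := \row_i (s i * f i).
  have := nontop_quadratic_bound x Asym uA uu eigsA lam01.
  have -> : (x *m x^T) 0 0 = \sum_i p i * f i ^+ 2.
    by rewrite mxE; apply: eq_bigr => i _; rewrite !mxE mulrACA ss.
  have -> : (x *m u^T) 0 0 = \sum_i p i * f i.
    by rewrite mxE; apply: eq_bigr => i _; rewrite !mxE mulrAC ss.
  have -> : (x *m A *m x^T) 0 0 = \sum_i p i * (f i * \sum_j W i j * f j).
    rewrite -mulmxA mxE; apply: eq_bigr => i _; rewrite !mxE !mulr_sumr.
    apply: eq_bigr => j _; rewrite !mxE -ss -[RHS]mul1r -[X in _ = X * _](mulfV (s0 j)).
    by rewrite [LHS]mulrC; ring.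
  by rewrite BE expr2.
have polar : B g h *+ 4 = B (g \+ h) (g \+ h) - B (g \- h) (g \- h).
  have Bl f1 f2 f3 : B (f1 \+ f2) f3 = B f1 f3 + B f2 f3.
    rewrite /B -big_split; apply: eq_bigr => i _; rewrite -big_split /=.
    by apply: eq_bigr => j _; ring.
  have BN f1 f2 : B (\- f1) f2 = - B f1 f2.
    rewrite /B -sumrN; apply: eq_bigr => i _; rewrite -sumrN.
    by apply: eq_bigr => j _ /=; ring.
  have -> : B (g \- h) (g \- h) = B (g \+ \- h) (g \+ \- h) by [].
  rewrite !Bl !(Bsym _ (_ \+ _)) !Bl !BN !(Bsym _ (\- _)) !BN (Bsym h g); ring.
have sumsq : \sum_i p i * (g \+ h) i ^+ 2 + \sum_i p i * (g \- h) i ^+ 2 =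
    (\sum_i p i * g i ^+ 2 + \sum_i p i * h i ^+ 2) *+ 2.
  by rewrite -!big_split -sumrMnl /=; apply: eq_bigr => i _; ring.
have := Bquad (g \+ h); have := Bquad (g \- h).
rewrite !ler_norml => /andP[b1 _] /andP[_ b2].
rewrite -BE; move: b1 b2 sumsq polar.
move: (\sum_i _) (\sum_i _) (\sum_i p i * g i ^+ 2 + _) (B _ _) (B _ _) (B _ _) => X Y Z b a c.
nra.
Qed.

(** * Link measures *)

(** Both sides are the trinomial coefficient [(a + b + s)! / (a! b! s!)]. *)
Lemma mul_bin_trinomial a b s :
  ('C(a + s, s) * 'C(a + b + s, a + s) = 'C(a + b + s, s) * 'C(a + b, a))%N.
Proof.
have f0 n : (0 < n`!)%N := fact_gt0 n.
apply/eqP; rewrite -(eqn_pmul2r (f0 s)) -(eqn_pmul2r (f0 a)) -(eqn_pmul2r (f0 b)).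
have e1 : ('C(a + s, s) * (s`! * a`!) = (a + s)`!)%N.
  by rewrite -(bin_fact (leq_addl a s)) addnK.
have e2 : ('C(a + b + s, a + s) * ((a + s)`! * b`!) = (a + b + s)`!)%N.
  rewrite -(@bin_fact (a + b + s) (a + s)); last by rewrite -addnA addnCA addnC leq_addl.
  by congr (_ * (_ * _`!))%N; rewrite addnAC addKn.
have e3 : ('C(a + b + s, s) * (s`! * (a + b)`!) = (a + b + s)`!)%N.
  by rewrite -(bin_fact (leq_addl (a + b) s)) addnK.
have e4 : ('C(a + b, a) * (a`! * b`!) = (a + b)`!)%N.
  by rewrite -(bin_fact (leq_addr b a)) addKn.
apply/eqP; transitivity ((a + b + s)`!).
  by rewrite -e2 -e1; ring.
by rewrite -e3 -e4; ring.
Qed.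

Lemma disjointsU (T : finType) (A B C : {set T}) :
  [disjoint A :|: B & C] = [disjoint A & C] && [disjoint B & C].
Proof. by rewrite !disjoints_subset subUset. Qed.

Lemma card_disjointsU (T : finType) (A B : {set T}) :
  [disjoint A & B] -> #|A :|: B| = (#|A| + #|B|)%N.
Proof. by move=> /disjoint_setI0 AB; rewrite cardsU AB cards0 subn0. Qed.

Section LinkMeasure.
Variables (R : rcfType) (V : finType) (d : nat) (w : {set V} -> R).
Hypothesis w_weight : is_weight d w.
Local Notation pr := (link_pr d w).
Local Notation isf := (is_face d w).

Let w_ge0 s : 0 <= w s. Proof. by case: w_weight. Qed.
Let w_card s : w s != 0 -> #|s| = d.+1. Proof. by case: w_weight => _ h _; apply: h. Qed.

Lemma face_pr_ge0 u : 0 <= face_pr d w u.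
Proof. by rewrite mulr_ge0 ?invr_ge0 ?ler0n // sumr_ge0. Qed.

Lemma link_pr_ge0 s a : 0 <= pr s a.
Proof.
rewrite /link_pr; case: ifP => // _.
by rewrite mulr_ge0 ?face_pr_ge0 // invr_ge0 mulr_ge0 ?ler0n ?face_pr_ge0.
Qed.

Lemma is_faceE s : isf s = (face_pr d w s != 0).
Proof. by rewrite /is_face lt_def face_pr_ge0 andbT. Qed.

Lemma is_face_card s : isf s -> (#|s| <= d.+1)%N.
Proof.
rewrite is_faceE; case: leqP => // h; rewrite /face_pr bin_small // invr0 mulr0.
by rewrite eqxx.
Qed.

Lemma sub_is_face (s t : {set V}) : s \subset t -> isf t -> isf s.
Proof.
move=> st ft; have ct := is_face_card ft; move: ft; rewrite /is_face /face_pr.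
have cs : (#|s| <= d.+1)%N := leq_trans (subset_leq_card st) ct.
rewrite !pmulr_lgt0 ?invr_gt0 ?ltr0n ?bin_gt0 //.
move=> /lt_le_trans; apply; rewrite [leRHS](bigID (fun r : {set V} => t \subset r)) /=.
rewrite [X in X + _](eq_bigl (fun r : {set V} => t \subset r)) ?lerDl ?sumr_ge0 // => r.
by case: (boolP (t \subset r)) => h; rewrite ?andbF ?andbT // (subset_trans st h).
Qed.

Lemma link_pr_face s a : pr s a != 0 -> isf (s :|: a).
Proof.
rewrite /link_pr is_faceE; case: ifP; rewrite ?eqxx // setUC => _.
by apply: contraNneq => ->; rewrite mul0r.
Qed.

Lemma link_pr_disjoint s a : pr s a != 0 -> [disjoint a & s].
Proof. by rewrite /link_pr; case: ifP; rewrite ?eqxx. Qed.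

(** Chain rule: drawing [a] and then [b] in successive links amounts to drawing their union and then
    a uniform subset of size [#|a|] of it. *)
Lemma link_prU (s a b : {set V}) : [disjoint a & b] ->
  pr s a * pr (s :|: a) b = pr s (a :|: b) / ('C(#|a| + #|b|, #|a|))%:R.
Proof.
rewrite disjoint_sym => dba; rewrite /link_pr !disjointsU.
rewrite ![[disjoint b & _]]disjoint_sym disjointsU [[disjoint a & b]]disjoint_sym dba andbT.
rewrite [[disjoint s & b]]disjoint_sym.
case: (boolP [disjoint a & s]) => das; last by rewrite !mul0r.
case: (boolP [disjoint b & s]) => dbs; last by rewrite mulr0 mul0r.
have cab : #|a :|: b| = (#|a| + #|b|)%N.
  by rewrite card_disjointsU // disjoint_sym.
have cas : #|a :|: s| = (#|a| + #|s|)%N by rewrite card_disjointsU.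
have cabs : #|a :|: b :|: s| = (#|a| + #|b| + #|s|)%N.
  by rewrite -cab card_disjointsU // disjointsU das.
rewrite /= (setUC s a) setUA (setUC b a) cas cabs.
set A := face_pr d w (a :|: s); set B := face_pr d w (a :|: b :|: s); set E := face_pr d w s.
(* The factor [A] cancels only when nonzero. Otherwise [s :|: a] is not a face, hence neither is any
   superset, and both sides vanish. *)
have [A0|A0] := eqVneq A 0.
  have -> : B = 0; last by rewrite A0 !mul0r.
  apply/eqP; move: A0 => /eqP; apply: contraLR; rewrite -!is_faceE.
  by apply: sub_is_face; apply/subsetP => x; rewrite !inE => /orP[]->; rewrite ?orbT.
clearbody A B E; have h := mul_bin_trinomial #|a| #|b| #|s|.
have c1 : ('C(#|a| + #|s|, #|s|))%:R != 0 :> R by rewrite pnatr_eq0 -lt0n bin_gt0 leq_addl.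
have c2 : ('C(#|a| + #|b| + #|s|, #|a| + #|s|))%:R != 0 :> R.
  by rewrite pnatr_eq0 -lt0n bin_gt0 addnAC leq_addr.
have c3 : ('C(#|a| + #|b| + #|s|, #|s|))%:R != 0 :> R.
  by rewrite pnatr_eq0 -lt0n bin_gt0 leq_addl.
have c4 : ('C(#|a| + #|b|, #|a|))%:R != 0 :> R.
  by rewrite pnatr_eq0 -lt0n bin_gt0 leq_addr.
move/(congr1 (fun n => n%:R : R)): h; rewrite !natrM => h.
transitivity (B / E / ('C(#|a| + #|s|, #|s|)%:R * 'C(#|a| + #|b| + #|s|, #|a| + #|s|)%:R)).
  by rewrite !invfM -[RHS]mul1r -[X in _ = X * _](mulfV A0); ring.
by rewrite h !invfM; ring.
Qed.

Lemma link_prC s a b : pr s a * pr (s :|: a) b = pr s b * pr (s :|: b) a.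
Proof.
have [dab|ndab] := boolP [disjoint a & b].
  rewrite !link_prU // 1?disjoint_sym // setUC addnC -bin_sub ?leq_addl //.
  by rewrite addnK.
suff h (x y : {set V}) : ~~ [disjoint x & y] -> pr (s :|: x) y = 0.
  by rewrite !h ?mulr0 // disjoint_sym.
rewrite disjoint_sym => nd; rewrite /link_pr disjoint_sym disjointsU disjoint_sym (disjoint_sym x).
by rewrite (negPf nd) andbF.
Qed.

(** Double counting: every top face [r] containing [s] has ['C(d.+1 - #|s|, i)] subsets of size [i]
    outside [s]. The size condition keeps this binomial nonzero. *)
Lemma link_pr_sum1 s i : isf s -> (#|s| + i <= d.+1)%N ->
  \sum_(a : {set V} | #|a| == i) pr s a = 1.
Proof.
move=> fs si; pose M := \sum_(r : {set V} | s \subset r) w r.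
have cs : 'C(d.+1, #|s|)%:R != 0 :> R.
  by rewrite pnatr_eq0 -lt0n bin_gt0 (leq_trans (leq_addr _ _) si).
have M0 : M != 0.
  by move: fs; rewrite is_faceE /face_pr; apply: contraNneq => M0; rewrite -/M M0 mul0r.
have ci : 'C(d.+1 - #|s|, i)%:R != 0 :> R.
  by rewrite pnatr_eq0 -lt0n bin_gt0 leq_subRL ?(leq_trans (leq_addr _ _) si).
have E (a : {set V}) : #|a| == i -> pr s a =
    (M * 'C(d.+1 - #|s|, i)%:R)^-1 * \sum_(r : {set V} | s \subset r) (a \subset r :\: s)%:R * w r.
  move=> /eqP ai; rewrite /link_pr; case: ifP => das; last first.
    rewrite big1 ?mulr0 // => r _; rewrite subsetD das andbF mul0r //.
  have cas : #|a :|: s| = (i + #|s|)%N by rewrite card_disjointsU // ai.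
  rewrite /face_pr cas -/M; clearbody M.
  have -> : \sum_(r : {set V} | s \subset r) (a \subset r :\: s)%:R * w r = \sum_(r : {set V} | a :|: s \subset r) w r.
    rewrite big_mkcond [RHS]big_mkcond; apply: eq_bigr => r _.
    rewrite subUset subsetD das andbT andbC; case: (s \subset r) => //=.
    by case: (a \subset r); rewrite ?mul1r ?mul0r.
  set S := \sum_(r | _) _.
  have := mul_bin_trinomial i (d.+1 - (#|s| + i)) #|s|.
  have -> : (i + (d.+1 - (#|s| + i)) + #|s| = d.+1)%N by rewrite addnAC (addnC i) subnKC.
  have -> : (i + (d.+1 - (#|s| + i)) = d.+1 - #|s|)%N by rewrite subnDA subnKC // leq_subRL // (leq_trans _ si) ?leq_addr.
  move/(congr1 (fun n => n%:R : R)); rewrite !natrM => h.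
  have c1 : ('C(i + #|s|, #|s|))%:R != 0 :> R by rewrite pnatr_eq0 -lt0n bin_gt0 leq_addl.
  have c2 : 'C(d.+1, i + #|s|)%:R != 0 :> R.
    by rewrite pnatr_eq0 -lt0n bin_gt0 addnC.
  transitivity (S / M * 'C(d.+1, #|s|)%:R / ('C(i + #|s|, #|s|)%:R * 'C(d.+1, i + #|s|)%:R)).
    by rewrite !invfM invrK; ring.
  by rewrite h !invfM -[RHS]mul1r -[X in _ = X * _](mulfV cs); ring.
rewrite (eq_bigr _ E) -mulr_sumr exchange_big /=.
rewrite (eq_bigr (fun r => 'C(d.+1 - #|s|, i)%:R * w r)).
  by rewrite -mulr_sumr -/M [_ * M]mulrC mulVf // mulf_neq0.
move=> r sr; rewrite -mulr_suml; have [->|wr] := eqVneq (w r) 0; first by rewrite !mulr0.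
congr (_ * _); have -> : (d.+1 - #|s| = #|r :\: s|)%N.
  by rewrite cardsD (setIidPr sr) (w_card wr).
rewrite -cards_draws.
rewrite -sum1_card natr_sum [RHS]big_mkcond [LHS]big_mkcond /=.
by apply: eq_bigr => a _; rewrite inE andbC; case: (_ == i); case: (_ \subset _).
Qed.

(** Each [c] with a marked vertex [v] corresponds to the pair of [v] and [c :\ v]; the factor is the
    binomial of [link_prU] for sizes 1 and [i]. *)
Lemma link_pr_split s i (psi : V -> {set V} -> R) :
  \sum_(c : {set V} | #|c| == i.+1) pr s c * \sum_(v in c) psi v (c :\ v) =
  i.+1%:R * \sum_v pr s [set v] * \sum_(a : {set V} | #|a| == i) pr (s :|: [set v]) a * psi v a.
Proof.
transitivity (\sum_v \sum_(a : {set V} | (#|a| == i) && (v \notin a)) pr s (v |: a) * psi v a).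
  under eq_bigr do rewrite mulr_sumr.
  rewrite (exchange_big_dep predT) //=; apply: eq_bigr => v _.
  rewrite (reindex_onto (fun a => v |: a) (fun c => c :\ v)) /=; last first.
    by move=> c /andP[_ vc]; rewrite setD1K.
  apply: eq_big => [a|a /andP[_ /eqP ->]] //.
  rewrite setU11 andbT cardsU1; apply/andP/andP => [[/eqP h /eqP h2]|[/eqP h na]].
    have na : v \notin a by rewrite -h2 setD11.
    by move: h; rewrite na add1n => -[->].
  by rewrite na h setU1K // eqxx.
rewrite mulr_sumr; apply: eq_bigr => v _.
rewrite mulr_sumr mulr_sumr big_mkcondr /=; apply: eq_bigr => a /eqP ai; case: ifP => [na|/negbFE va].
  rewrite mulrA mulrA -[_ * _ * pr _ a]mulrA link_prU ?disjoints1 // cards1 ai bin1 add1n.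
  by rewrite mulrCA mulfV ?pnatr_eq0 // mulr1.
have -> : pr (s :|: [set v]) a = 0; last by rewrite mul0r !mulr0.
by rewrite /link_pr disjoint_sym disjointsU disjoints1 va andbF.
Qed.

End LinkMeasure.

(** * Covariances over disjoint faces *)

Section Expectation.
Variables (R : rcfType) (V : finType) (d : nat) (w : {set V} -> R).
Hypothesis w_weight : is_weight d w.
Local Notation pr := (link_pr d w).
Local Notation isf := (is_face d w).
Implicit Types (s a b : {set V}) (g h : {set V} -> R).

(** The index [i] is a cardinality, one more than the dimension, so X(k) appears as [k.+1]. *)
Definition expect s i g : R := \sum_(a : {set V} | #|a| == i) pr s a * g a.

Lemma eq_expect s i g h :
  (forall a, #|a| = i -> pr s a != 0 -> g a = h a) -> expect s i g = expect s i h.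
Proof.
move=> gh; apply: eq_bigr => a /eqP ai.
by have [->|pa] := eqVneq (pr s a) 0; rewrite ?mul0r // gh.
Qed.

Lemma le_expect s i g h :
  (forall a, #|a| = i -> pr s a != 0 -> g a <= h a) -> expect s i g <= expect s i h.
Proof.
move=> gh; apply: ler_sum => a /eqP ai.
have [->|pa] := eqVneq (pr s a) 0; first by rewrite !mul0r.
by rewrite ler_wpM2l ?link_pr_ge0 // gh.
Qed.

Lemma expect_ge0 s i g : (forall a, 0 <= g a) -> 0 <= expect s i g.
Proof. by move=> g0; apply: sumr_ge0 => a _; rewrite mulr_ge0 ?link_pr_ge0. Qed.

Lemma expectD s i g h : expect s i (fun a => g a + h a) = expect s i g + expect s i h.
Proof. by rewrite -big_split; apply: eq_bigr => a _; rewrite mulrDr. Qed.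

Lemma expectZ s i c g : expect s i (fun a => c * g a) = c * expect s i g.
Proof. by rewrite /expect mulr_sumr; apply: eq_bigr => a _; rewrite mulrCA. Qed.

Lemma expect_sum (I : finType) s i (g : I -> {set V} -> R) :
  expect s i (fun a => \sum_j g j a) = \sum_j expect s i (g j).
Proof. by rewrite /expect exchange_big; apply: eq_bigr => a _; rewrite mulr_sumr. Qed.

Lemma expect_cst s i c : isf s -> (#|s| + i <= d.+1)%N -> expect s i (fun=> c) = c.
Proof. by move=> fs si; rewrite /expect -mulr_suml (link_pr_sum1 w_weight) ?mul1r. Qed.

Lemma expect_sqr_sub s i g c : isf s -> (#|s| + i <= d.+1)%N ->
  expect s i (fun a => (g a - c) ^+ 2) =
  expect s i (fun a => g a ^+ 2) - 2 * c * expect s i g + c ^+ 2.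
Proof.
move=> fs si; rewrite -[in RHS](expect_cst (c ^+ 2) fs si) -mulNr -expectZ -!expectD.
by apply: eq_expect => a _ _; ring.
Qed.

Lemma sqr_expect_le s i g : isf s -> (#|s| + i <= d.+1)%N ->
  expect s i g ^+ 2 <= expect s i (fun a => g a ^+ 2).
Proof.
move=> fs si; have : 0 <= expect s i (fun a => (g a - expect s i g) ^+ 2).
  by apply: expect_ge0 => a; apply: sqr_ge0.
by rewrite expect_sqr_sub //; move: (expect s i g) => m; nra.
Qed.

Lemma expectC s i j (F : {set V} -> {set V} -> R) :
  expect s i (fun a => expect (s :|: a) j (F a)) =
  expect s j (fun b => expect (s :|: b) i (F^~ b)).
Proof.
rewrite /expect; under eq_bigr do rewrite mulr_sumr.
rewrite exchange_big; apply: eq_bigr => b _; rewrite mulr_sumr.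
by apply: eq_bigr => a _; rewrite !mulrA (link_prC w_weight).
Qed.

Lemma link_pr_faceU s i a : (#|s| + i <= d.+1)%N -> #|a| = i -> pr s a != 0 ->
  isf (s :|: a) /\ (#|s :|: a| = #|s| + i)%N.
Proof.
move=> si ai pa; split; first exact: link_pr_face.
by rewrite card_disjointsU ?ai // disjoint_sym; exact: link_pr_disjoint pa.
Qed.

Lemma expect_link s i j h : (#|s| + i + j <= d.+1)%N -> isf s ->
  expect s i (fun a => expect (s :|: a) j h) = expect s j h.
Proof.
move=> sij fs; rewrite expectC; apply: eq_expect => b bj pb.
have [|fb cb] := link_pr_faceU _ bj pb; first by rewrite (leq_trans _ sij) // addnAC leq_addr.
by rewrite expect_cst // cb addnAC.
Qed.

Lemma sum_singletons (F : {set V} -> R) :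
  \sum_(a : {set V} | #|a| == 1%N) F a = \sum_v F [set v].
Proof.
rewrite (reindex_omap (set1 : V -> _) (fun a => [pick x in a])) /=; last first.
  move=> a /cards1P[x ->]; case: pickP => [y /set1P->//|/(_ x)].
  by rewrite set11.
apply: eq_bigl => v; rewrite cards1 eqxx; case: pickP => [y /set1P->|/(_ v)].
  by rewrite eqxx.
by rewrite set11.
Qed.

Lemma expect1 s g : expect s 1 g = \sum_v pr s [set v] * g [set v].
Proof. exact: sum_singletons. Qed.

Lemma expect0 s g : isf s -> expect s 0 g = g set0.
Proof.
move=> fs; have E F : \sum_(a : {set V} | #|a| == 0%N) F a = F set0 :> R.
  by rewrite (eq_bigl (pred1 set0)) ?big_pred1_eq // => a; rewrite cards_eq0.
have := link_pr_sum1 w_weight (i := 0) fs; rewrite addn0 E => p1.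
by rewrite /expect E p1 ?mul1r // (is_face_card w_weight).
Qed.

Lemma expect_vertices s i (psi : V -> {set V} -> R) :
  expect s i.+1 (fun c => \sum_(v in c) psi v (c :\ v)) =
  i.+1%:R * \sum_v pr s [set v] * expect (s :|: [set v]) i (psi v).
Proof. exact: link_pr_split. Qed.

(** A face [c] arises once from each of its [i.+1] vertices, which cancels the factor in
    [expect_vertices]. *)
Lemma expectS s i g :
  expect s i.+1 g = expect s 1 (fun x => expect (s :|: x) i (fun a => g (x :|: a))).
Proof.
rewrite expect1; apply: (@mulfI _ i.+1%:R); first by rewrite pnatr_eq0.
rewrite -(expect_vertices s i (fun v a => g (v |: a))) -expectZ.
apply: eq_expect => c ci _; rewrite (eq_bigr (fun=> g c)) => [|v vc]; last by rewrite setD1K.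
by rewrite sumr_const ci mulr_natl.
Qed.

(* In the link of [s], the pair [(a, b)] is a random pair of disjoint faces. *)
Definition walk_cov s i j g h : R :=
  expect s i (fun a => g a * expect (s :|: a) j h) - expect s i g * expect s j h.

(** A sum of second moments, instead of a product of norms, averages linearly when a vertex is
    conditioned on; rescaling [g] and [h] recovers the product. *)
Definition cov_bound i j (c : R) := forall s g h,
  isf s -> (#|s| + i + j <= d.+1)%N ->
  walk_cov s i j g h <=
    c / 2 * (expect s i (fun a => g a ^+ 2) + expect s j (fun b => h b ^+ 2)).

Lemma walk_covC s i j g h : walk_cov s i j g h = walk_cov s j i h g.
Proof.
rewrite /walk_cov [X in _ - X]mulrC; congr (_ - _).
under eq_expect => a _ _ do rewrite -expectZ.
rewrite expectC; apply: eq_expect => b _ _.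
by rewrite -expectZ; apply: eq_expect => a _ _; rewrite mulrC.
Qed.

Lemma cov_bound_sym i j c : cov_bound i j c -> cov_bound j i c.
Proof.
move=> H s g h fs; rewrite addnAC => sij; rewrite walk_covC addrC; exact: H.
Qed.

Lemma cov_bound0 j : cov_bound 0 j 0.
Proof.
by move=> s g h fs _; rewrite /walk_cov !expect0 // setU0 subrr !mul0r.
Qed.

(* The law of total covariance, conditioning on one vertex [x] of [a]. *)
Lemma cov_boundS i j c c' : 0 <= c -> 0 <= c' ->
  cov_bound i j c -> cov_bound 1 j c' -> cov_bound i.+1 j (c + c').
Proof.
move=> c0 c0' Hc Hc' s g h fs sij.
have sij' : (#|s| + 1 + i + j <= d.+1)%N by rewrite -(addnA #|s|) add1n.
have s1j : (#|s| + 1 + j <= d.+1)%N by rewrite (leq_trans _ sij') // leq_add2r leq_addr.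
have s1i : (#|s| + 1 + i <= d.+1)%N by rewrite (leq_trans _ sij') ?leq_addr.
have s1 : (#|s| + 1 <= d.+1)%N by rewrite (leq_trans _ s1i) ?leq_addr.
pose g1 (x : {set V}) := expect (s :|: x) i (fun a => g (x :|: a)).
have Ex (x : {set V}) : #|x| = 1%N -> pr s x != 0 -> isf (s :|: x) /\ (#|s :|: x| = #|s| + 1)%N.
  exact: link_pr_faceU.
have split_cov : walk_cov s i.+1 j g h =
    expect s 1 (fun x => walk_cov (s :|: x) i j (fun a => g (x :|: a)) h) +
    walk_cov s 1 j g1 h.
  rewrite /walk_cov addrA !(expectS s i) -/g1; congr (_ - _); rewrite -expectD.
  apply: eq_expect => x _ _; rewrite /g1 subrK.
  by apply: eq_expect => a _ _; rewrite setUA.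
rewrite split_cov mulrDl mulrDl; apply: lerD.
  apply: (le_trans (y := expect s 1 (fun x => c / 2 *
    (expect (s :|: x) i (fun a => g (x :|: a) ^+ 2) + expect (s :|: x) j (fun b => h b ^+ 2))))).
    apply: le_expect => x x1 px; have [fx cx] := Ex x x1 px.
    by apply: Hc => //; rewrite cx.
  by rewrite expectZ expectD expect_link // (expectS s i (fun a => g a ^+ 2)).
apply: le_trans (Hc' _ _ _ fs s1j) _.
rewrite ler_wpM2l ?divr_ge0 // lerD2r (expectS s i).
apply: le_expect => x x1 px; have [fx cx] := Ex x x1 px.
by apply: sqr_expect_le; rewrite // cx.
Qed.

(** Each of the [i * j] pairs of vertices costs one [lam]: [cov_boundS] builds up one index at a
    time, and symmetry exchanges the two. *)
Lemma cov_bound_mul lam i j : 0 <= lam ->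
  cov_bound 1 1 lam -> cov_bound i j (i%:R * j%:R * lam).
Proof.
move=> lam0 H; have H1 m : cov_bound m 1 (m%:R * lam).
  elim: m => [|m IH]; first by rewrite mul0r; apply: cov_bound0.
  by rewrite -addn1 natrD mulrDl mul1r addn1; apply: cov_boundS => //; rewrite mulr_ge0.
elim: i => [|i IH]; first by rewrite !mul0r; apply: cov_bound0.
rewrite -addn1 natrD mulrDl mulrDl mul1r addn1; apply: cov_boundS => //.
- by rewrite !mulr_ge0.
- by rewrite mulr_ge0.
exact/cov_bound_sym/H1.
Qed.

(* Apply the covariance bound to a multiple of [g - E g] and its image under the walk. *)
Lemma variance_contraction i j c s g : 0 < c -> cov_bound i j c ->
  isf s -> (#|s| + i + j <= d.+1)%N ->
  expect s j (fun b => (expect (s :|: b) i g - expect s i g) ^+ 2) <=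
  c ^+ 2 * expect s i (fun a => (g a - expect s i g) ^+ 2).
Proof.
move=> c0 H fs sij; set mu := expect s i g.
have si : (#|s| + i <= d.+1)%N := leq_trans (leq_addr _ _) sij.
have sj : (#|s| + j <= d.+1)%N by rewrite (leq_trans _ sij) // addnAC leq_addr.
pose g' a := c * (g a - mu); pose h b := expect (s :|: b) i g - mu.
have g'0 : expect s i g' = 0.
  rewrite expectZ expectD expect_cst //.
  by rewrite subrr mulr0.
have := H s g' h fs sij; rewrite walk_covC /walk_cov g'0 mulr0 subr0.
rewrite (eq_expect (h := fun b => c * h b ^+ 2)) => [|b bj pb]; last first.
  have [fb cb] := link_pr_faceU sj bj pb.
  rewrite expectZ expectD expect_cst //; first by rewrite /h; ring.
  by rewrite cb addnAC.
rewrite expectZ (eq_expect (g := fun a => g' a ^+ 2) (h := fun a => c ^+ 2 * (g a - mu) ^+ 2)); last first.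
  by move=> a _ _; rewrite /g' exprMn.
rewrite expectZ -/(h _); move: (expect _ _ _) (expect _ _ _) => X Y.
rewrite mulrAC -mulrA ler_pM2l //; lra.
Qed.
End Expectation.

(** * From eigenvalues to covariances along edges *)

Section Base.
Variables (R : rcfType) (V : finType) (d : nat) (w : {set V} -> R) (lam : R).
Hypothesis w_weight : is_weight d w.
Hypotheses (lam01 : 0 <= lam < 1) (X_exp : two_sided_link_expander d w lam).
Local Notation pr := (link_pr d w).

(** The walk on the underlying graph of the link of [s] moves from [a] to [b] with probability [pr
    (s :|: [set a]) [set b]]. By [link_prC] it is reversible with respect to the vertex measure, so
    the spectral bound applies. *)
Lemma cov_bound_edges : cov_bound d w 1 1 lam.
Proof.
move=> s g h fs; rewrite -addnA => s2.
have s1 : (#|s| + 1 <= d.+1)%N by rewrite (leq_trans _ s2) // leq_add2l.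
have sd : (#|s| <= d.-1)%N by move: s2; rewrite addn2 ltnS; case: (d) => // m; rewrite ltnS.
(* The factor 2 appears because an edge is unordered; it cancels in the transition probabilities. *)
have edgeE a b : link_edge d w s a b = 2 * (pr s [set a] * pr (s :|: [set a]) [set b]).
  rewrite /link_edge; have [->|ab] := eqVneq a b.
    by rewrite /(link_pr _ _ (_ :|: _)) disjoints1 inE set11 orbT !mulr0.
  rewrite (link_prU w_weight) ?disjoints1 ?inE // !cards1 bin1.
  by rewrite mulrCA mulfV ?pnatr_eq0 // mulr1.
have prs1 a : pr s [set a] != 0 -> \sum_b pr (s :|: [set a]) [set b] = 1.
  move=> pa; have [fa ca] := link_pr_faceU w_weight s1 (cards1 a) pa.
  by rewrite -sum_singletons (link_pr_sum1 w_weight) // ca -addnA.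
set vs := link_verts d w s.
have vsE a : (a \in vs) = (pr s [set a] != 0).
  by rewrite inE lt_def link_pr_ge0 // andbT.
(* The walk matrix is indexed by vertices of positive measure only, so sums over [V] must lose their
   null terms. *)
have sum_vs (F : V -> R) : (forall a, pr s [set a] = 0 -> F a = 0) ->
    \sum_a F a = \sum_(i < #|vs|) F (enum_val i).
  move=> F0; rewrite -(big_enum_val F) [RHS]big_mkcond; apply: eq_bigr => a _.
  by rewrite vsE; case: eqP => // /F0.
have WE (i j : 'I_#|vs|) : link_walk d w s i j =
    pr (s :|: [set enum_val i]) [set enum_val j].
  have pi : pr s [set enum_val i] != 0 by rewrite -vsE enum_valP.
  rewrite mxE; under [X in _ / X]eq_bigr do rewrite edgeE.
  rewrite -!mulr_sumr prs1 // mulr1 edgeE [X in X / _]mulrA mulrAC mulfV ?mul1r //.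
  by rewrite mulf_neq0 // pnatr_eq0.
have pr0 a b : pr s [set b] = 0 -> pr s [set a] * pr (s :|: [set a]) [set b] = 0.
  by move=> pb; rewrite (link_prC w_weight) pb mul0r.
have rowE (F : V -> R) (i : 'I_#|vs|) :
    \sum_j link_walk d w s i j * F (enum_val j) =
    \sum_b pr (s :|: [set enum_val i]) [set b] * F b.
  rewrite (sum_vs (fun b => pr (s :|: [set enum_val i]) [set b] * F b)).
    by apply: eq_bigr => j _; rewrite WE.
  move=> b pb; have := pr0 (enum_val i) _ pb => /eqP.
  have /negPf ni : pr s [set enum_val i] != 0 by rewrite -vsE enum_valP.
  by rewrite mulf_eq0 ni => /eqP ->; rewrite mul0r.
have E1 (F : {set V} -> R) : expect d w s 1 F =
    \sum_(i < #|vs|) pr s [set enum_val i] * F [set enum_val i].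
  by rewrite expect1 (sum_vs (fun v => pr s [set v] * F [set v])) // => a ->; rewrite mul0r.
rewrite /walk_cov !E1.
have -> : \sum_(i < #|vs|) pr s [set enum_val i] *
    (g [set enum_val i] * expect d w (s :|: [set enum_val i]) 1 h) =
    \sum_(i < #|vs|) pr s [set enum_val i] *
    (g [set enum_val i] * \sum_j link_walk d w s i j * h [set enum_val j]).
  by apply: eq_bigr => i _; rewrite (rowE (fun v => h [set v])) expect1.
apply: (@reversible_cov_bound _ _ (link_walk d w s) (fun i => pr s [set enum_val i])
  _ _ _ _ _ _ _ (fun i => g [set enum_val i]) (fun i => h [set enum_val i])) => //.
- by move=> i; have := enum_valP i; rewrite inE.
- rewrite -(link_pr_sum1 w_weight fs s1) sum_singletons.
  by rewrite (sum_vs (fun a => pr s [set a])).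
- by move=> i j; rewrite !WE (link_prC w_weight).
- move=> i; have := rowE (fun=> 1) i; under eq_bigr do rewrite mulr1; move=> ->.
  by under eq_bigr do rewrite mulr1; rewrite prs1 // -vsE enum_valP.
exact: X_exp.
Qed.
End Base.

(** Centering lets the second moments in [cov_bound] be replaced by variances. *)
Lemma walk_cov_subl (R : rcfType) (V : finType) d (w : {set V} -> R) s i j c
    (g h : {set V} -> R) : is_weight d w -> is_face d w s -> (#|s| + i + j <= d.+1)%N ->
  walk_cov d w s i j (fun a => g a - c) h = walk_cov d w s i j g h.
Proof.
move=> ww fs sij; have si : (#|s| + i <= d.+1)%N := leq_trans (leq_addr _ _) sij.
rewrite /walk_cov expectD expect_cst //.
have -> : expect d w s i (fun a => (g a - c) * expect d w (s :|: a) j h) =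
    expect d w s i (fun a => g a * expect d w (s :|: a) j h) - c * expect d w s j h.
  rewrite -(expect_link ww h sij fs) -mulNr -expectZ -expectD.
  by apply: eq_expect => a _ _; ring.
by ring.
Qed.

(** * Colorings of the faces of a link *)

Section Colorings.
Variables (R : rcfType) (V : finType) (d : nat) (w : {set V} -> R).
Hypothesis w_weight : is_weight d w.
Local Notation pr := (link_pr d w).
Local Notation isf := (is_face d w).
Local Notation expect := (expect d w).
Variable (C : finType).
Implicit Types (s a b : {set V}) (chi : {set V} -> C).

Definition freq s i chi c : R := expect s i (fun a => (chi a == c)%:R).

Definition clash s i chi : R :=
  expect s i (fun a => expect s i (fun b => (chi a != chi b)%:R)).

Lemma sum_freq s i chi : isf s -> (#|s| + i <= d.+1)%N -> \sum_c freq s i chi c = 1.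
Proof.
move=> fs si; rewrite -expect_sum -[RHS](expect_cst w_weight 1 fs si).
apply: eq_expect => a _ _; rewrite (bigD1 (chi a)) //= eqxx big1 ?addr0 // => c.
by rewrite eq_sym => /negPf ->.
Qed.

Lemma freq_ge0 s i chi c : 0 <= freq s i chi c.
Proof. by apply: expect_ge0 => // a; apply: ler0n. Qed.

Lemma expect_neq s i a chi : isf s -> (#|s| + i <= d.+1)%N ->
  expect s i (fun b => (chi a != chi b)%:R) = 1 - freq s i chi (chi a).
Proof.
move=> fs si; rewrite -[X in _ = X - _](expect_cst w_weight 1 fs si) -mulN1r -expectZ -expectD.
apply: eq_expect => b _ _; rewrite eq_sym.
by case: (_ == _); rewrite ?mulr1 ?subrr ?mulr0 ?addr0.
Qed.

Lemma sum_colors (F : C -> R) c : \sum_c' (c == c')%:R * F c' = F c.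
Proof.
rewrite (bigD1 c) //= eqxx mul1r big1 ?addr0 // => c'.
by rewrite eq_sym => /negPf ->; rewrite mul0r.
Qed.

Lemma clashE s i chi : isf s -> (#|s| + i <= d.+1)%N ->
  clash s i chi = 1 - \sum_c freq s i chi c ^+ 2.
Proof.
move=> fs si; rewrite -[X in _ = X - _](expect_cst w_weight 1 fs si) /clash.
have -> : \sum_c freq s i chi c ^+ 2 = expect s i (fun a => freq s i chi (chi a)).
  under eq_bigr => c _ do rewrite expr2 {2}/freq -expectZ.
  rewrite -expect_sum; apply: eq_expect => a _ _.
  by under eq_bigr do rewrite mulrC; rewrite sum_colors.
rewrite -mulN1r -expectZ -expectD; apply: eq_expect => a _ _.
by rewrite expect_neq // mulN1r.
Qed.

Lemma clash_ge0 s i chi : 0 <= clash s i chi.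
Proof. by do 2![apply: expect_ge0 => // ?]; apply: ler0n. Qed.

(** The indicator of a color of frequency [p] has variance [p - p ^+ 2], and the frequencies sum to
    1. Thus bounds on variances apply to clashes, color by color. *)
Lemma sum_variance s i chi : isf s -> (#|s| + i <= d.+1)%N ->
  \sum_c expect s i (fun a => ((chi a == c)%:R - freq s i chi c) ^+ 2) = clash s i chi.
Proof.
move=> fs si; rewrite clashE // -[X in _ = X - _](sum_freq chi fs si) -sumrB; apply: eq_bigr => c _.
rewrite expect_sqr_sub //.
rewrite (eq_expect (h := fun a => (chi a == c)%:R)) => [|a _ _]; last first.
  by case: (_ == _) ; rewrite ?expr1n ?expr0n.
by rewrite -/(freq s i chi c); ring.
Qed.

(** Summed over all colors, the walk covariances of the indicators give the clash probability of
    independent faces minus that of disjoint walk pairs; the variances sum to the clash. *)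
Lemma clash_walk s i chi c : cov_bound d w i i c -> isf s -> (#|s| + i + i <= d.+1)%N ->
  (1 - c) * clash s i chi <=
  expect s i (fun a => expect (s :|: a) i (fun b => (chi a != chi b)%:R)).
Proof.
move=> H fs sii; have si : (#|s| + i <= d.+1)%N := leq_trans (leq_addr _ _) sii.
set D := clash s i chi; set W := expect s i _.
pose g x a : R := (chi a == x)%:R; pose p x := expect s i (g x).
have cov x : walk_cov d w s i i (g x) (g x) <=
    c / 2 * (expect s i (fun a => (g x a - p x) ^+ 2) +
             expect s i (fun a => (g x a - p x) ^+ 2)).
  have := H s (fun a => g x a - p x) (fun a => g x a - p x) fs sii.
  by rewrite walk_cov_subl // walk_covC // walk_cov_subl.
have : \sum_x walk_cov d w s i i (g x) (g x) <= c * D.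
  apply: (le_trans (ler_sum _ (fun x _ => cov x))).
  rewrite -mulr_sumr big_split /= !sum_variance // -/D; lra.
suff -> : \sum_x walk_cov d w s i i (g x) (g x) = D - W by lra.
have -> : D = 1 - \sum_x p x * p x.
  by rewrite /D clashE //; congr (_ - _); apply: eq_bigr => x _; rewrite expr2.
rewrite /walk_cov sumrB; suff -> : \sum_x expect s i (fun a => g x a * expect (s :|: a) i (g x)) = 1 - W.
  by rewrite /p; ring.
rewrite -expect_sum -[X in _ = X - _](expect_cst w_weight 1 fs si) -mulN1r -expectZ -expectD.
apply: eq_expect => a ai pa; rewrite sum_colors expect_neq //.
- by rewrite mulN1r opprB addrC subrK.
- by case: (link_pr_faceU w_weight si ai pa).
by case: (link_pr_faceU w_weight si ai pa) => _ ->.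
Qed.

Definition drift s i chi b : R :=
  \sum_c (freq (s :|: b) i chi c - freq s i chi c) ^+ 2.

Lemma drift_ge0 s i chi b : 0 <= drift s i chi b.
Proof. by apply: sumr_ge0 => c _; apply: sqr_ge0. Qed.

Lemma drift_le s i j chi c : 0 < c -> cov_bound d w i j c ->
  isf s -> (#|s| + i + j <= d.+1)%N ->
  expect s j (drift s i chi) <= c ^+ 2 * clash s i chi.
Proof.
move=> c0 H fs sij; have si : (#|s| + i <= d.+1)%N := leq_trans (leq_addr _ _) sij.
rewrite -sum_variance // mulr_sumr expect_sum; apply: ler_sum => x _.
exact: variance_contraction.
Qed.

(** The frequency in the link of [s :|: b] averages to that in the link of [s], so its variance is a
    difference of mean squares, and [clashE] turns squares into clashes. *)
Lemma expect_drift s i j chi : isf s -> (#|s| + i + j <= d.+1)%N ->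
  expect s j (drift s i chi) = clash s i chi - expect s j (fun b => clash (s :|: b) i chi).
Proof.
move=> fs sij; have si : (#|s| + i <= d.+1)%N := leq_trans (leq_addr _ _) sij.
have sj : (#|s| + j <= d.+1)%N by rewrite (leq_trans _ sij) // addnAC leq_addr.
have -> : expect s j (fun b => clash (s :|: b) i chi) =
    1 - \sum_c expect s j (fun b => freq (s :|: b) i chi c ^+ 2).
  rewrite -expect_sum -[X in _ = X - _](expect_cst w_weight 1 fs sj) -mulN1r -expectZ -expectD.
  apply: eq_expect => b bj pb; have [fb cb] := link_pr_faceU w_weight sj bj pb.
  by rewrite clashE ?cb ?mulN1r // addnAC.
rewrite clashE //; transitivity (\sum_c (expect s j (fun b => freq (s :|: b) i chi c ^+ 2) -
    freq s i chi c ^+ 2)); last by rewrite sumrB; ring.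
rewrite expect_sum; apply: eq_bigr => c _; rewrite expect_sqr_sub //.
have -> : expect s j (fun b => freq (s :|: b) i chi c) = freq s i chi c.
  by apply: expect_link => //; rewrite addnAC.
ring.
Qed.

Lemma clash_link s i j chi c : 0 < c -> cov_bound d w i j c ->
  isf s -> (#|s| + i + j <= d.+1)%N ->
  (1 - c ^+ 2) * clash s i chi <= expect s j (fun b => clash (s :|: b) i chi).
Proof.
move=> c0 H fs sij; have := drift_le chi c0 H fs sij; rewrite expect_drift //; lra.
Qed.

(** The sum of squared frequencies is the mean frequency of a random color, so the largest frequency
    is at least this. *)
Lemma exists_freq s i chi : isf s -> (#|s| + i <= d.+1)%N ->
  exists c, 1 - clash s i chi <= freq s i chi c.
Proof.
move=> fs si; have s1 := sum_freq chi fs si.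
(* The color type is inhabited, since an empty sum of frequencies could not be 1. *)
have [c0 _] : exists c : C, true.
  case: (pickP (predT : pred C)) => [c _|no]; first by exists c.
  by move: s1; rewrite big_pred0 // => /eqP; rewrite eq_sym oner_eq0.
have [c _ maxc] := arg_maxP (freq s i chi) (isT : predT c0).
exists c; rewrite clashE // opprB addrC subrK -[leRHS]mul1r -[X in _ <= X * _]s1 mulr_suml.
by apply: ler_sum => x _; rewrite expr2 ler_wpM2l ?freq_ge0 //; apply: maxc.
Qed.

Lemma freqD_le1 s i chi x y : isf s -> (#|s| + i <= d.+1)%N -> x != y ->
  freq s i chi x + freq s i chi y <= 1.
Proof.
move=> fs si xy; rewrite -[leRHS](sum_freq chi fs si) (bigD1 x) //= (bigD1 y) 1?eq_sym //=.
by rewrite addrA lerDl sumr_ge0 // => c _; apply: freq_ge0.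
Qed.

End Colorings.

(** * Agreement *)

Section Hitting.
Variables (R : rcfType) (V : finType) (d : nat) (w : {set V} -> R).
Hypothesis w_weight : is_weight d w.
Local Notation pr := (link_pr d w).
Local Notation isf := (is_face d w).
Local Notation expect := (expect d w).

(** Second moment method for the number [N] of vertices of [t] in [B]: its mean [mu] exceeds 1, and
    the edge covariance bound yields a second moment of at most [3 * mu ^+ 2]. *)
Lemma hitting_bound (lam : R) (s : {set V}) (B : pred V) l : (0 < l)%N ->
  cov_bound d w 1 1 lam -> isf s -> (#|s| + l.+1 <= d.+1)%N ->
  0 <= lam -> lam * l%:R <= 16^-1 ->
  l%:R^-1 < \sum_v pr s [set v] * (B v)%:R ->
  3^-1 <= expect s l.+1 (fun t => (~~ [forall v in t, ~~ B v])%:R).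
Proof.
(* From here the original [l] reads [l.+1], and [t] has [l.+2] vertices. *)
case: l => // l _ H fs sl lam0 laml; set b := \sum_v _ => bl.
have s2 : (#|s| + 1 + 1 <= d.+1)%N by rewrite -addnA (leq_trans _ sl) // leq_add2l.
pose N (t : {set V}) : R := \sum_(v in t) (B v)%:R.
have N1 v : N [set v] = (B v)%:R by rewrite /N big_set1.
have e1 : expect s 1 N = b by rewrite expect1; apply: eq_bigr => v _; rewrite N1.
have Bsq v : (B v)%:R ^+ 2 = (B v)%:R :> R by case: (B v); rewrite ?expr1n ?expr0n.
have e2 : expect s 1 (fun a => N a ^+ 2) = b.
  by rewrite expect1; apply: eq_bigr => v _; rewrite N1 Bsq.
have EN s' m : isf s' -> (#|s'| + m.+1 <= d.+1)%N ->
    expect s' m.+1 N = m.+1%:R * expect s' 1 N.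
  move=> fs' sm; rewrite (expect_vertices w_weight s' m (fun v _ => (B v)%:R)); congr (_ * _).
  rewrite expect1; apply: eq_bigr => v _; rewrite N1.
  have [->|pv] := eqVneq (pr s' [set v]) 0; first by rewrite !mul0r.
  have s1 : (#|s'| + 1 <= d.+1)%N by rewrite (leq_trans _ sm) // leq_add2l.
  have [fv cv] := link_pr_faceU w_weight s1 (cards1 v) pv.
  by rewrite expect_cst // cv -addnA.
have EN1 : expect s l.+2 N = l.+2%:R * b by rewrite EN ?e1.
have EN2 : expect s l.+2 (fun t => N t ^+ 2) <=
    l.+2%:R * b + l.+2%:R * l.+1%:R * (b ^+ 2 + lam * b).
  have -> : expect s l.+2 (fun t => N t ^+ 2) =
      l.+2%:R * b + l.+2%:R * l.+1%:R * expect s 1 (fun a => N a * expect (s :|: a) 1 N).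
    (* [N t ^+ 2] counts ordered pairs in [B]: 1 for the diagonal and [N (t :\ v)] for the partners
       of [v]. *)
    rewrite (eq_expect (h := fun t => \sum_(v in t) (B v)%:R * (1 + N (t :\ v)))).
      rewrite (expect_vertices w_weight s l.+1 (fun v a => (B v)%:R * (1 + N a))).
      rewrite -mulrA -mulrDr; congr (_ * _).
      rewrite -e1 -expectZ -expectD expect1; apply: eq_bigr => v _.
      have [->|pv] := eqVneq (pr s [set v]) 0; first by rewrite !mul0r.
      have s1 : (#|s| + 1 <= d.+1)%N by rewrite (leq_trans _ s2) ?leq_addr.
      have [fv cv] := link_pr_faceU w_weight s1 (cards1 v) pv.
      have sl' : (#|s :|: [set v]| + l.+1 <= d.+1)%N by rewrite cv -addnA.
      rewrite N1 expectZ expectD expect_cst // EN //; congr (_ * _); ring.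
    move=> t _ _; rewrite expr2 {1}/N mulr_suml; apply: eq_bigr => v vt.
    rewrite /N (big_setD1 v) //= -/(N _) mulrDr -expr2 Bsq mulrDr mulr1 //.
  have := H s N N fs s2; rewrite /walk_cov e1 e2 => h.
  rewrite lerD2l ler_wpM2l ?mulr_ge0 //; move: h; lra.
set mu : R := l.+2%:R * b in EN1 EN2.
have l0 : (0 : R) < l.+1%:R by rewrite ltr0n.
have b0 : 0 < b by apply: lt_trans bl; rewrite invr_gt0.
have lb : 1 < l.+1%:R * b by rewrite mulrC -ltr_pdivrMr // div1r.
have l2E : l.+2%:R = l.+1%:R + 1 :> R by rewrite -natr1.
have mu1 : 1 < mu by rewrite /mu l2E mulrDl mul1r (lt_trans lb) // ltrDl.
(* The three terms are at most [mu], [mu ^+ 2] and [mu / 16], and [mu > 1]. *)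
have E3 : expect s l.+2 (fun t => N t ^+ 2) <= 3 * mu ^+ 2.
  apply: le_trans EN2 _.
  have -> : l.+2%:R * l.+1%:R * (b ^+ 2 + lam * b) = mu * (l.+1%:R * b) + mu * (lam * l.+1%:R).
    by rewrite /mu; ring.
  have h1 : l.+1%:R * b <= mu by rewrite /mu l2E mulrDl mul1r lerDl ltW.
  have h2 : mu * (l.+1%:R * b) <= mu * mu by rewrite ler_wpM2l // ltW // (lt_trans ltr01).
  have h3 : mu * (lam * l.+1%:R) <= mu * 16^-1 by rewrite ler_wpM2l // ltW // (lt_trans ltr01).
  by move: h2 h3 mu1; move: (mu * (_ * b)) (mu * (lam * _)) => x y; nra.
pose x := (3 * mu)^-1.
have mun0 : mu != 0 by rewrite gt_eqF // (lt_trans ltr01).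
have xmu : x * mu = 3^-1 by rewrite /x invfM mulfVK.
(* Pointwise [1[N > 0] >= 2 x N - (x N)^2]; the choice of [x] optimizes the bound. *)
apply: (le_trans (y := expect s l.+2 (fun t => 2 * x * N t + - x ^+ 2 * N t ^+ 2))).
  rewrite expectD !expectZ EN1 -mulrA xmu mulNr.
  have : x ^+ 2 * expect s l.+2 (fun t => N t ^+ 2) <= x ^+ 2 * (3 * mu ^+ 2).
    by rewrite ler_wpM2l // sqr_ge0.
  have -> : x ^+ 2 * (3 * mu ^+ 2) = 3^-1.
    by rewrite mulrCA -exprMn xmu expr2 mulrA mulfV ?mul1r // pnatr_eq0.
  move: (x ^+ 2 * _) => y; lra.
apply: le_expect => // t _ _; case: forall_inP => /= [tB|_].
  have -> : N t = 0 by rewrite /N big1 // => v /tB /negPf ->.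
  by rewrite expr0n /= !mulr0 addr0.
by have := sqr_ge0 (1 - x * N t); clearbody x; move: (N t) => n; nra.
Qed.
End Hitting.

(** * The plurality assignment and the two tests *)

Section Agreement.
Variables (R : rcfType) (V S : finType) (l k d : nat) (w : {set V} -> R).
Hypothesis w_weight : is_weight d w.
Variable f : {set V} -> V -> S.
Local Notation pr := (link_pr d w).
Local Notation isf := (is_face d w).
Local Notation expect := (expect d w).
Implicit Types (t z : {set V}).

(** The restriction of [f z] to [t], padded by [None] so that all restrictions lie in one finite
    color type. *)
Definition pattern t z : {ffun V -> option S} :=
  [ffun v => if v \in t then Some (f z v) else None].

Lemma eq_pattern t z1 z2 : (pattern t z1 == pattern t z2) = agree_on f z1 z2 t.
Proof.
apply/eqP/forall_inP => [/ffunP E v vt|E].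
  by have := E v; rewrite !ffunE vt => -[->].
by apply/ffunP => v; rewrite !ffunE; case: ifP => // /E /eqP ->.
Qed.

Lemma face_pr_link t : face_pr d w t = pr set0 t.
Proof.
rewrite /link_pr disjoint_sym disjoints_subset sub0set setU0 cards0 bin0 mul1r.
have -> : face_pr d w set0 = 1; last by rewrite divr1.
rewrite /face_pr cards0 bin0 divr1; case: w_weight => _ _ <-.
by apply: eq_bigl => s; rewrite sub0set.
Qed.

Lemma weak_indep_rejE :
  weak_indep_rej d w l k f = expect set0 l.+1 (fun t => clash d w t k.+1 (pattern t)).
Proof.
rewrite /weak_indep_rej; apply: eq_bigr => t _; rewrite face_pr_link; congr (_ * _).
apply: eq_bigr => z1 _; rewrite mulr_sumr; apply: eq_bigr => z2 _.
by rewrite eq_pattern mulrA.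
Qed.

(** By [link_prU], splitting a random face uniformly into halves is the same as drawing [z1] and
    then [z2] in the link of [t :|: z1]. *)
Lemma weak_compl_rejE :
  weak_compl_rej d w l k f = expect set0 l.+1 (fun t => expect t k.+1 (fun z1 =>
    expect (t :|: z1) k.+1 (fun z2 => (pattern t z1 != pattern t z2)%:R))).
Proof.
rewrite /weak_compl_rej; apply: eq_bigr => t _; rewrite face_pr_link; congr (_ * _).
rewrite [RHS]big_mkcond; apply: eq_bigr => z1 _; case: (boolP (#|z1| == k.+1)) => [c1|c1].
  rewrite mulr_sumr [RHS]big_mkcond; apply: eq_bigr => z2 _; rewrite /compl_walk_pr c1.
  case: (boolP (#|z2| == k.+1)) => [c2|_]; last by rewrite /= andbF mul0r.
  rewrite /= andbT eq_pattern mulrA; congr (_ * _).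
  have [d12|nd] := boolP [disjoint z1 & z2].
    by rewrite link_prU // (eqP c1) (eqP c2) addnn.
  by rewrite /(link_pr _ _ (_ :|: _)) disjoint_sym disjointsU (negPf nd) andbF mulr0.
by rewrite big1 // => z2 _; rewrite /compl_walk_pr (negPf c1) /= andbF mul0r.
Qed.

Lemma exists_plurality : exists G : V -> S, forall v c,
  freq d w [set v] k.+1 (f^~ v) c <= freq d w [set v] k.+1 (f^~ v) (G v).
Proof.
pose F v := freq d w [set v] k.+1 (f^~ v).
(* The value [f set0 v] only witnesses that [S] is inhabited. *)
exists (fun v => [arg max_(c > f set0 v) F v c]%O) => v c.
by case: arg_maxP => // c' _; apply.
Qed.

(* The right-hand side is at least 1 unless the clash probability is below 1/4 and every
   drift is below 1/16; then the dominant pattern on [t] is the restriction of [G]. *)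
Lemma far_from_plurality_le (G : V -> S) t :
  (forall v c, freq d w [set v] k.+1 (f^~ v) c <= freq d w [set v] k.+1 (f^~ v) (G v)) ->
  isf t -> (#|t| + k.+1 <= d.+1)%N ->
  expect t k.+1 (fun z => (~~ [forall v in t, f z v == G v])%:R) <=
  4 * clash d w t k.+1 (pattern t) +
  16 * \sum_(v in t) drift d w [set v] k.+1 (f^~ v) (t :\ v).
Proof.
move=> Gmax ft tk; set L := expect _ _ _; set e := clash _ _ _ _ _.
have e0 : 0 <= e by apply: clash_ge0.
have dr0 v : 0 <= drift d w [set v] k.+1 (f^~ v) (t :\ v) by apply: drift_ge0.
have L1 : L <= 1.
  rewrite -[leRHS](expect_cst w_weight 1 ft tk); apply: le_expect => // z _ _.
  by case: (~~ _).
have [e4|e4] := leP 4^-1 e.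
  apply: le_trans L1 _; have : 0 <= \sum_(v in t) drift d w [set v] k.+1 (f^~ v) (t :\ v).
    by apply: sumr_ge0 => v _.
  lra.
have [/exists_inP[v vt dv]|nodrift] := boolP
    [exists v in t, 16^-1 <= drift d w [set v] k.+1 (f^~ v) (t :\ v)].
  apply: le_trans L1 _; rewrite (bigD1 v) //=.
  have : 0 <= \sum_(i in t | i != v) drift d w [set i] k.+1 (f^~ i) (t :\ i).
    by apply: sumr_ge0 => u _.
  move: (\sum_(i in t | _) _) => x; lra.
have [tau tauE] := exists_freq w_weight (pattern t) ft tk; rewrite -/e in tauE.
have tauG v : v \in t -> tau v = Some (G v).
  move=> vt; have dv : drift d w [set v] k.+1 (f^~ v) (t :\ v) < 16^-1.
    by rewrite ltNge; apply: contra nodrift => h; apply/exists_inP; exists v.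
  have [c tauc] : exists c, tau v = Some c.
    have : 0 < freq d w t k.+1 (pattern t) tau by lra.
    case tv : (tau v) => [c|]; first by exists c.
    suff -> : freq d w t k.+1 (pattern t) tau = 0 by rewrite ltxx.
    rewrite /freq -[RHS](expect_cst w_weight 0 ft tk); apply: eq_expect => z _ _.
    case: eqP => // E; have := congr1 (fun g : {ffun V -> option S} => g v) E.
    by rewrite ffunE vt tv.
  rewrite tauc; congr Some; apply/eqP/negPn/negP => cG.
  have h1 : freq d w t k.+1 (pattern t) tau <= freq d w t k.+1 (f^~ v) c.
    apply: le_expect => // z _ _; case: eqP => [E|_]; last exact: ler0n.
    have := congr1 (fun g : {ffun V -> option S} => g v) E.
    by rewrite ffunE vt tauc => -[->]; rewrite eqxx.
  have h2 : (freq d w t k.+1 (f^~ v) c - freq d w [set v] k.+1 (f^~ v) c) ^+ 2 < 16^-1.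
    apply: le_lt_trans dv; rewrite /drift setD1K // (bigD1 c) //= lerDl.
    by apply: sumr_ge0 => x _; apply: sqr_ge0.
  have vsub : [set v] \subset t by rewrite sub1set.
  have fv := sub_is_face w_weight vsub ft.
  have vk : (#|[set v]| + k.+1 <= d.+1)%N.
    by rewrite (leq_trans _ tk) // leq_add2r subset_leq_card.
  (* The color [c] has frequency above 3/4 over the link of [t], hence above 1/2 over that of [v].
     So has the plurality value [G v], and two distinct colors cannot both exceed 1/2. *)
  have := freqD_le1 w_weight (f^~ v) fv vk cG; have := Gmax v c.
  move: (freq _ _ _ _ _ (G v)) h1 h2 => g h1 h2; nra.
apply: (le_trans (y := 1 - freq d w t k.+1 (pattern t) tau)).
  rewrite -[X in _ <= X - _](expect_cst w_weight 1 ft tk) -mulN1r -expectZ -expectD.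
  apply: le_expect => // z _ _; case: (boolP (pattern t z == tau)) => [/eqP E|_]; last first.
    by case: (~~ _); rewrite mulr0 addr0.
  rewrite (_ : [forall v in t, _]) ?mulr1 ?subrr //.
  apply/forall_inP => v vt; have := tauG v vt; rewrite -E ffunE vt => -[->] //.
have : 0 <= \sum_(v in t) drift d w [set v] k.+1 (f^~ v) (t :\ v).
  by apply: sumr_ge0 => v _.
move: tauE; lra.
Qed.

(** A disagreement at one vertex of [t] is a disagreement of patterns. Conditioning on a random
    vertex [v] of [t] leaves the passage from the link of [v] to that of [t], which is
    [clash_link]. *)
Lemma clash_vertices_le lam : 0 < lam -> cov_bound d w k.+1 l lam ->
  (l.+1 + k.+1 <= d.+1)%N ->
  (1 - lam ^+ 2) * \sum_v pr set0 [set v] * clash d w [set v] k.+1 (f^~ v) <=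
  expect set0 l.+1 (fun t => clash d w t k.+1 (pattern t)).
Proof.
move=> lam0 H lk; rewrite (expectS w_weight) expect1 mulr_sumr.
apply: ler_sum => v _; rewrite mulrCA.
have [->|pv] := eqVneq (pr set0 [set v]) 0; first by rewrite !mul0r.
rewrite ler_wpM2l ?link_pr_ge0 // !set0U.
have fv : isf [set v] by have := link_pr_face w_weight pv; rewrite set0U.
have vkl : (#|[set v]| + k.+1 + l <= d.+1)%N by rewrite cards1 addnAC add1n.
apply: le_trans (clash_link w_weight (f^~ v) lam0 H fv vkl) _.
apply: le_expect => // a _ _; apply: le_expect => // z1 _ _; apply: le_expect => // z2 _ _.
rewrite eq_pattern ler_nat; case: (boolP (agree_on _ _ _ _)) => [/forall_inP|_]; last exact: leq_b1.
by move=> /(_ v); rewrite !inE eqxx => /(_ isT) ->.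
Qed.

(** With [z] drawn before [t], [hitting_bound] applies in the link of each far [z]; the factor 3
    inverts its bound. *)
Lemma far_fraction_le lam (G : V -> S) :
  (0 < l)%N -> (l.+1 + k.+1 <= d.+1)%N ->
  (forall v c, freq d w [set v] k.+1 (f^~ v) c <= freq d w [set v] k.+1 (f^~ v) (G v)) ->
  0 <= lam -> lam * l%:R <= 16^-1 -> cov_bound d w 1 1 lam ->
  far_fraction d w l k f G <=
  3 * expect set0 l.+1 (fun t => expect t k.+1 (fun z => (~~ [forall v in t, f z v == G v])%:R)).
Proof.
move=> l0 lk Gmax lam0 laml H.
have -> : far_fraction d w l k f G = expect set0 k.+1 (fun z =>
    ((l%:R^-1 : R) < \sum_(v : V) pr z [set v] * (f z v != G v)%:R)%R%:R).
  by apply: eq_bigr => z _; rewrite face_pr_link.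
pose F t z : R := (~~ [forall v in t, f z v == G v])%:R.
have -> : expect set0 l.+1 (fun t => expect t k.+1 (F t)) =
    expect set0 k.+1 (fun z => expect z l.+1 (F^~ z)).
  transitivity (expect set0 l.+1 (fun t => expect (set0 :|: t) k.+1 (F t))).
    by apply: eq_expect => t _ _; rewrite set0U.
  by rewrite expectC //; apply: eq_expect => z _ _; rewrite set0U.
rewrite -expectZ; apply: le_expect => // z zk pz.
case: ltP => [far|_]; last by rewrite mulr_ge0 // expect_ge0 // => t; apply: ler0n.
have fz : isf z by have := link_pr_face w_weight pz; rewrite set0U.
have zl : (#|z| + l.+1 <= d.+1)%N by rewrite zk addnC.
have := hitting_bound w_weight l0 H fz zl lam0 laml far.
have -> : expect z l.+1 (fun t => (~~ [forall v in t, ~~ (f z v != G v)])%:R) =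
    expect z l.+1 (F^~ z).
  apply: eq_expect => t _ _; congr (~~ _)%:R.
  by apply: eq_forallb => v; rewrite negbK.
by rewrite mulr1n; move: (expect _ _ _) => x; lra.
Qed.

Lemma exists_agreement lam : (4 <= l)%N -> (l + k.+1 <= d)%N ->
  0 < lam -> lam * l%:R <= 16^-1 -> k.+1%:R * l%:R * lam * l%:R <= 1 ->
  cov_bound d w 1 1 lam ->
  exists G : V -> S, far_fraction d w l k f G <= 30 * weak_indep_rej d w l k f.
Proof.
move=> l4 lkd lam0 laml Lam_le H.
have l0 : (0 < l)%N by rewrite (leq_trans _ l4).
have lk : (l.+1 + k.+1 <= d.+1)%N by rewrite addSn ltnS.
have [G Gmax] := exists_plurality; exists G.
apply: le_trans (far_fraction_le l0 lk Gmax (ltW lam0) laml H) _.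
rewrite weak_indep_rejE; set e := expect set0 l.+1 (fun t => clash _ _ _ _ _).
have e0 : 0 <= e by apply: expect_ge0 => // t; apply: clash_ge0.
pose Lam : R := k.+1%:R * l%:R * lam.
have Lam0 : 0 < Lam by rewrite /Lam !mulr_gt0 // ltr0n.
(* Here [l] is the size of [t :\ v]. *)
have HLam : cov_bound d w k.+1 l Lam by apply: cov_bound_mul => //; apply: ltW.
pose D := \sum_v pr set0 [set v] * clash d w [set v] k.+1 (f^~ v).
have D0 : 0 <= D.
  by apply: sumr_ge0 => v _; rewrite mulr_ge0 ?clash_ge0 // link_pr_ge0.
have De : (1 - Lam ^+ 2) * D <= e by apply: clash_vertices_le.
have : expect set0 l.+1 (fun t => expect t k.+1 (fun z => (~~ [forall v in t, f z v == G v])%:R)) <=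
    4 * e + 16 * (l.+1%:R * (Lam ^+ 2 * D)).
  apply: (le_trans (y := expect set0 l.+1 (fun t => 4 * clash d w t k.+1 (pattern t) +
      16 * \sum_(v in t) drift d w [set v] k.+1 (f^~ v) (t :\ v)))).
    apply: le_expect => // t tl pt; apply: far_from_plurality_le; rewrite ?tl //.
    by have := link_pr_face w_weight pt; rewrite set0U.
  rewrite expectD !expectZ lerD2l ler_wpM2l //.
  rewrite (expect_vertices w_weight set0 l (fun v => drift d w [set v] k.+1 (f^~ v))).
  rewrite ler_wpM2l // mulr_sumr; apply: ler_sum => v _.
  have [->|pv] := eqVneq (pr set0 [set v]) 0; first by rewrite !mul0r mulr0.
  rewrite mulrCA ler_wpM2l ?link_pr_ge0 // set0U.
  apply: drift_le => //; first by have := link_pr_face w_weight pv; rewrite set0U.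
  by rewrite cards1 addnAC add1n.
have L4 : (4 : R) <= l%:R by rewrite (ler_nat R 4 l).
rewrite -[l.+1%:R]natr1; move: D De D0 L4 Lam_le Lam0; rewrite -/Lam; clearbody Lam e.
move: (l%:R : R) => L D De D0 L4 LamL Lam0 h.
have Lam4 : Lam <= 4^-1.
  have : Lam * 4 <= Lam * L by rewrite ler_pM2l.
  lra.
have q1 : Lam ^+ 2 <= 16^-1.
  have : Lam * Lam <= Lam * 4^-1 by rewrite ler_pM2l.
  rewrite -expr2; lra.
have q2 : (L + 1) * Lam ^+ 2 <= 5 / 16.
  have : Lam * (Lam * L) <= Lam * 1 by rewrite ler_pM2l.
  lra.
have q3 : (L + 1) * (Lam ^+ 2 * D) <= 5 / 16 * D by rewrite mulrA ler_wpM2r.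
have q4 : Lam ^+ 2 * D <= 16^-1 * D by rewrite ler_wpM2r.
(* As [D <= 16 / 15 * e], the total is at most [3 * (4 + 5 * 16 / 15) * e = 28 * e]. *)
move: h; move: (expect _ _ _) => X h; lra.
Qed.

(** Apply [clash_walk] to the patterns in the link of each [t], with covariance constant at most
    1/4. *)
Lemma weak_indep_le_compl lam : 0 <= lam -> (l + k.*2 + 2 <= d)%N ->
  k.+1%:R * k.+1%:R * lam <= 4^-1 -> cov_bound d w 1 1 lam ->
  3 / 4 * weak_indep_rej d w l k f <= weak_compl_rej d w l k f.
Proof.
move=> lam0 lkd lamk H; rewrite weak_indep_rejE weak_compl_rejE -expectZ.
apply: le_expect => // t tl pt.
have ft : isf t by have := link_pr_face w_weight pt; rewrite set0U.
have tk : (#|t| + k.+1 + k.+1 <= d.+1)%N.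
  by rewrite tl -addnA addnn doubleS addSn ltnS -addn2 addnA.
have Hk : cov_bound d w k.+1 k.+1 (k.+1%:R * k.+1%:R * lam) by apply: cov_bound_mul.
apply: le_trans (clash_walk w_weight (pattern t) Hk ft tk).
by rewrite ler_wpM2r ?clash_ge0 //; lra.
Qed.

End Agreement.

(** * Choice of parameters and conclusion *)

Theorem theorem5p3 :
  exists c : rat, 0 < c /\
  forall (R : rcfType) (V S : finType) (l k d : nat) (w : {set V} -> R),
    (4 <= l)%N -> (l.*2 + 2 <= d)%N -> (l + k.*2 + 2 <= d)%N ->
    is_weight d w ->
    two_sided_link_expander d w ((l%:R * (k + l)%:R ^+ 2)^-1) ->
    forall (f : {set V} -> V -> S) (eps : R),
      eps = weak_indep_rej d w l k f \/ eps = weak_compl_rej d w l k f ->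
      exists G : V -> S, far_fraction d w l k f G <= ratr c * eps.
Proof.
(* The constant is 30 from the independent test, divided by the 3/4 lost for the complement test. *)
exists 40; split=> // R V S l k d w l4 _ lkd ww X_exp f eps eps_rej.
rewrite ratr_nat.
set lam := (_ * _)^-1 in X_exp.
have L4 : (4 : R) <= l%:R by rewrite (ler_nat R 4 l).
have KL : l%:R <= (k + l)%:R :> R by rewrite ler_nat leq_addl.
have Kk : k.+1%:R <= (k + l)%:R :> R by rewrite ler_nat -addn1 leq_add2l (leq_trans _ l4).
have k1 : (1 : R) <= k.+1%:R by rewrite (ler_nat R 1).
(* With [K = k + l], all bounds follow from [lam * l * K ^+ 2 = 1], as [4 <= l <= K] and
   [k.+1 <= K]. *)
have [lam0 lamL lam1 Lam_le lamk] : [/\ 0 < lam, lam * l%:R <= 16^-1, lam < 1,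
    k.+1%:R * l%:R * lam * l%:R <= 1 & k.+1%:R * k.+1%:R * lam <= 4^-1].
  have lamE : lam * (l%:R * (k + l)%:R ^+ 2) = 1.
    by rewrite mulVf // mulf_neq0 ?expf_neq0 // gt_eqF //; lra.
  have lam0 : 0 < lam by rewrite invr_gt0 mulr_gt0 ?exprn_gt0 //; lra.
  move: lamE L4 KL Kk k1; clearbody lam.
  move: (l%:R : R) (k.+1%:R : R) ((k + l)%:R : R) => L k' K lamE L4 KL Kk k1.
  have K16 : 16 <= K ^+ 2 by nra.
  have kL : k' * L <= K ^+ 2 by rewrite expr2 ler_pM //; lra.
  have kk : k' * k' <= K ^+ 2 by rewrite expr2 ler_pM //; lra.
  have lamL : 0 < lam * L by rewrite mulr_gt0 //; lra.
  have lamL16 : lam * L <= 16^-1.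
    have : lam * L * 16 <= lam * L * K ^+ 2 by rewrite ler_pM2l.
    lra.
  split=> //.
  - have : lam * 1 <= lam * L by rewrite ler_pM2l //; lra.
    lra.
  - have : lam * L * (k' * L) <= lam * L * K ^+ 2 by rewrite ler_pM2l.
    lra.
  have : lam * (k' * k') <= lam * K ^+ 2 by rewrite ler_pM2l.
  have : 4 * (lam * K ^+ 2) <= L * (lam * K ^+ 2) by rewrite ler_wpM2r // mulr_ge0 ?sqr_ge0 // ltW.
  lra.
have H : cov_bound d w 1 1 lam.
  by apply: cov_bound_edges => //; rewrite ltW.
have lkd' : (l + k.+1 <= d)%N.
  by rewrite (leq_trans _ lkd) // -addnA leq_add2l -addn1 -addnn; apply: leq_add; rewrite ?leq_addr.
have [G far] := exists_agreement ww f l4 lkd' lam0 lamL Lam_le H.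
exists G; apply: le_trans far _.
have ind0 : 0 <= weak_indep_rej d w l k f.
  by rewrite (weak_indep_rejE _ _ ww); apply: expect_ge0 => // t; apply: clash_ge0.
case: eps_rej => ->; first by lra.
have := weak_indep_le_compl ww f (ltW lam0) lkd lamk H; lra.
Qed.
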